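(* There exists a unique representation basis $A \subseteq \mathbb{Z}$ for the integers such that $A(-x,x) \ge \frac{1}{8}x^{1/3}$ for all sufficiently large real numbers $x$.
   Context: For $A \subseteq \mathbb{Z}$ and $n \in \mathbb{Z}$, let $r_A(n)$ be the number of pairs $(a,a')$ with $a,a' \in A$, $a \le a'$ and $a+a'=n$. A set $A \subseteq \mathbb{Z}$ is a unique representation basis for the integers if $r_A(n)=1$ for every $n \in \mathbb{Z}$. For real $y \le x$, $A(y,x) = |A \cap [y,x]|$. *)

(* Defs.v *)
From mathcomp Require Import all_boot all_order all_algebra finmap.
From mathcomp Require Import all_classical all_reals all_analysis.

Set Implicit Arguments.
Unset Strict Implicit.
Unset Printing Implicit Defensive.

Import Order.TTheory GRing.Theory Num.Theory.
Import numFieldNormedType.Exports.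

Local Open Scope classical_set_scope.
Local Open Scope ring_scope.

Definition rep_pairs (A : set int) (n : int) : set (int * int) :=
  [set p | [/\ A p.1, A p.2, p.1 <= p.2 & p.1 + p.2 = n]].

(* fset_set sends infinite sets to the empty one, so an infinite number of
   representations is recorded as 0; hence [rep_count A n = 1] still means that
   n has exactly one representation. *)
Definition rep_count (A : set int) (n : int) : nat :=
  #|` fset_set (rep_pairs A n) |%fset.

Definition unique_representation_basis (A : set int) : Prop :=
  forall n : int, rep_count A n = 1%N.

(* The counted set is always finite, so the default value of fset_set on
   infinite sets plays no role. *)
Definition count_in (R : realType) (A : set int) (y x : R) : nat :=
  #|` fset_set (A `&` [set a : int | a%:~R \in `[y, x]]) |%fset.

(* Main.v *)
Require Import Defs.
From mathcomp Require Import all_boot all_order all_algebra finmap.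
From mathcomp Require Import all_classical all_reals all_analysis.
From mathcomp Require Import zify lra.

Import Order.TTheory GRing.Theory Num.Theory.
Import numFieldNormedType.Exports.

Local Open Scope classical_set_scope.
Local Open Scope ring_scope.

(** The basis is built greedily, two elements at a time. Given a finite Sidon
    set with [m] elements and an integer [n] that is not a sum of two of them,
    adjoining [b] and [n - b] represents [n] and keeps the set Sidon unless [b]
    solves one of [O(m ^ 3)] linear equations. Hence some [b] of size [O(m ^ 3)]
    works, and [n] itself can be taken of size [O(m ^ 2)], so that after [k]
    steps the [2 k] elements lie in [[- 32 k ^ 3, 32 k ^ 3]]. *)

Definition sidon (s : seq int) : Prop :=
  forall a b c d, a \in s -> b \in s -> c \in s -> d \in s ->
    a + b = c + d -> (a = c /\ b = d) \/ (a = d /\ b = c).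

Definition represents (s : seq int) (n : int) : Prop :=
  exists a b, [/\ a \in s, b \in s & a + b = n].

(** If [x] occurs on both sides of a collision, it cancels. Otherwise it occurs on one side only,
    once or twice, and these are the two excluded equations. *)
Lemma sidon_cons (x : int) (s : seq int) : sidon s ->
  (forall a b c, a \in s -> b \in s -> c \in s -> x + c <> a + b) ->
  (forall a b, a \in s -> b \in s -> x + x <> a + b) ->
  x \notin s -> sidon (x :: s).
Proof.
move=> sS h1 h2 xs.
have neq a : a \in s -> x <> a by move=> sa xa; rewrite xa sa in xs.
move=> a b c d; rewrite !inE.
move=> /predU1P[->|sa] /predU1P[->|sb] /predU1P[->|sc] /predU1P[->|sd] e.
- by left.
- by have := neq _ sd; lia.
- by have := neq _ sc; lia.
- by have := h2 _ _ sc sd; lia.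
- by have := neq _ sb; lia.
- by left; lia.
- by right; lia.
- by have := h1 _ _ _ sc sd sb; lia.
- by have := neq _ sa; lia.
- by right; lia.
- by left; lia.
- by have := h1 _ _ _ sc sd sa; lia.
- by have := h2 _ _ sa sb; lia.
- by have := h1 _ _ _ sa sb sd; lia.
- by have := h1 _ _ _ sa sb sc; lia.
- exact: sS.
Qed.

(** Pigeonhole: the [size s + 1] numbers [0, ..., size s] cannot all lie in [s]. *)
Lemma exists_small_notin (s : seq int) :
  exists2 j : nat, (j <= size s)%N & j%:Z \notin s.
Proof.
apply: contrapT => H.
suff /uniq_leq_size : {subset map Posz (iota 0 (size s).+1) <= s}.
  rewrite map_inj_uniq ?iota_uniq; last by move=> ? ? [].
  by rewrite size_map size_iota ltnn => /(_ isT).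
move=> _ /mapP[j + ->]; rewrite mem_iota /= => js.
by apply/negPn/negP => njs; apply: H; exists j.
Qed.

(* If [c * b = v] then [b = (v %/ c)%Z], which turns each forbidden equation
   into a single forbidden value. *)
Definition forbidden (s : seq int) (n : int) : seq int :=
  [seq a + p | a <- s, p <- [seq b - c | b <- s, c <- s]] ++
  [seq n + a - p | a <- s, p <- [seq b + c | b <- s, c <- s]] ++
  [seq ((a + b) %/ 2)%Z | a <- s, b <- s] ++
  [seq ((2 * n - (a + b)) %/ 2)%Z | a <- s, b <- s] ++
  [seq ((n + a - b) %/ 2)%Z | a <- s, b <- s] ++
  [seq ((n + a) %/ 3)%Z | a <- s] ++
  [seq ((2 * n - a) %/ 3)%Z | a <- s] ++
  [seq n - a | a <- s] ++ s ++
  [:: (n %/ 2)%Z].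

Lemma size_forbidden (s : seq int) (n : int) :
  size (forbidden s n) =
  (2 * size s ^ 3 + 3 * size s ^ 2 + 4 * size s + 1)%N.
Proof. by rewrite !size_cat !size_allpairs !size_map /=; lia. Qed.

(** [sidon_cons] is applied twice, to adjoin [b] and then [n - b]. Each collision to exclude pins
    [b] to a forbidden value, except [(n - b) + b = a + c]. *)
Lemma sidon_cons2 (s : seq int) (n b : int) : sidon s -> ~ represents s n ->
  b \notin forbidden s n -> sidon [:: n - b, b & s].
Proof.
move=> sS nrep; rewrite !mem_cat !negb_or.
case/and5P=> /allpairsP h1 /allpairsP h2 /allpairsP h3 /allpairsP h4.
case/and5P=> /allpairsP h5 /mapP h6 /mapP h7 /mapP h8.
case/and3P=> bs /eqP h9 _.
have sum a c : a \in s -> c \in s -> a + c <> n.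
  by move=> sa sc e; apply: nrep; exists a, c.
have {}h1 a c d : a \in s -> c \in s -> d \in s -> b + d <> a + c.
  move=> sa sc sd e; apply: h1; exists (a, c - d); split => //=; last by lia.
  by apply/allpairsP; exists (c, d).
have {}h2 a c d : a \in s -> c \in s -> d \in s -> n - b + d <> a + c.
  move=> sa sc sd e; apply: h2; exists (d, a + c); split => //=; last by lia.
  by apply/allpairsP; exists (a, c).
have {}h3 a c : a \in s -> c \in s -> b + b <> a + c.
  by move=> sa sc e; apply: h3; exists (a, c); split => //=; lia.
have {}h4 a c : a \in s -> c \in s -> (n - b) + (n - b) <> a + c.
  by move=> sa sc e; apply: h4; exists (a, c); split => //=; lia.
have {}h5 a c : a \in s -> c \in s -> n - b + a <> b + c.
  by move=> sa sc e; apply: h5; exists (a, c); split => //=; lia.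
have {}h6 a : a \in s -> n - b + a <> b + b.
  by move=> sa e; apply: h6; exists a => //; lia.
have {}h7 a : a \in s -> (n - b) + (n - b) <> b + a.
  by move=> sa e; apply: h7; exists a => //; lia.
have {}h8 a : a \in s -> n - b <> a.
  by move=> sa e; apply: h8; exists a => //; lia.
have {}h9 : n <> b + b by lia.
apply: sidon_cons; first exact: sidon_cons.
- move=> a c d; rewrite !inE.
  move=> /predU1P[->|sa] /predU1P[->|sc] /predU1P[->|sd].
  + by lia.
  + exact: h6.
  + by have := h8 _ sc; lia.
  + exact: h5.
  + by have := h8 _ sa; lia.
  + by have := h5 _ _ sd sa; lia.
  (* Here [b] cancels and leaves [n = a + c], ruled out because [s] does not represent [n]. *)
  + by have := sum _ _ sa sc; lia.
  + exact: h2.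
- move=> a c; rewrite !inE => /predU1P[->|sa] /predU1P[->|sc].
  + by lia.
  + exact: h7.
  + by have := h7 _ sa; lia.
  + exact: h4.
- rewrite inE negb_or; apply/andP; split; first by lia.
  by apply/negP => /h8.
Qed.

(** The enumeration [0, 0, 1, -1, 2, -2, ...]; its term of index [k] is at most [k] in absolute
    value, so the targets stay small. *)
Definition int_enum (k : nat) : int := if odd k then - k./2%:Z else k./2%:Z.

Lemma int_enum_surj (n : int) : exists k, int_enum k = n.
Proof.
rewrite /int_enum; case: n => n.
  by exists n.*2; rewrite odd_double doubleK.
by exists n.+1.*2.+1; rewrite /= odd_double /= uphalf_double; lia.
Qed.

(** If [int_enum k] is already a sum, a small integer outside the [size s ^ 2] pairwise sums
    replaces it as target, so that every step can adjoin exactly two elements. *)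
Lemma exists_unrepresented (s : seq int) (k : nat) : exists2 n : int,
  ~ represents s n /\ (represents s (int_enum k) \/ n = int_enum k) &
  (`|n| <= k + size s ^ 2)%N.
Proof.
have [rep|nrep] := pselect (represents s (int_enum k)); last first.
  by exists (int_enum k); [split => //; right|rewrite /int_enum; case: ifP; lia].
have [j js jn] := exists_small_notin [seq a + b | a <- s, b <- s].
exists j%:Z; last first.
  by rewrite size_allpairs mulnn in js; exact: (leq_trans js (leq_addl _ _)).
split; last by left.
case=> a [b [sa sb e]]; move/negP: jn; apply.
by apply/allpairsP; exists (a, b).
Qed.

Definition stage (k : nat) (s : seq int) : Prop :=
  [/\ sidon s, uniq s, size s = (2 * k)%N,
      forall a, a \in s -> (`|a| <= 32 * k ^ 3)%N &
      forall i, (i < k)%N -> represents s (int_enum i)].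

Lemma stage_extend (k : nat) (s : seq int) : stage k s ->
  exists2 s', stage k.+1 s' & {subset s <= s'}.
Proof.
move=> [sS us zs bs rs].
have [n [nrep krep] nk] := exists_unrepresented s k.
have [j jF jnF] := exists_small_notin (forbidden s n).
rewrite size_forbidden zs in jF; rewrite zs in nk.
have ss' : {subset s <= [:: n - j%:Z, j%:Z & s]}.
  by move=> a sa; rewrite !inE sa !orbT.
exists [:: n - j%:Z, j%:Z & s] => //; split.
- exact: sidon_cons2.
- move: jnF; rewrite !mem_cat !negb_or.
  case/and5P=> _ _ _ _ /and5P[_ _ _ /mapP nj /and3P[js /eqP jn2 _]] /=.
  rewrite us js !andbT inE negb_or; apply/andP; split.
    by lia.
  by apply/negP => njs; apply: nj; exists (n - j%:Z) => //; lia.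
- by rewrite /= zs; lia.
(* With [j <= 16 k^3 + 12 k^2 + 8 k + 1] and [|n| <= k + 4 k^2], both new elements are at most
   [16 k^3 + 16 k^2 + 9 k + 1] in absolute value, below [32 (k + 1)^3]. *)
- move=> a; rewrite !inE => /or3P[/eqP->|/eqP->|/bs]; nia.
- move=> i; rewrite ltnS leq_eqVlt => /predU1P[->|/rs].
    case: krep => [|<-].
      by case=> a [b [sa sb e]]; exists a, b; rewrite !ss'.
    by exists (n - j%:Z), j%:Z; rewrite !inE !eqxx ?orbT subrK.
  by case=> a [b [sa sb e]]; exists a, b; rewrite !ss'.
Qed.

Lemma exists_stages : exists S : nat -> seq int,
  (forall k, stage k (S k)) /\
  (forall k l, (k <= l)%N -> {subset S k <= S l}).
Proof.
(* Choice needs a total relation, so a pair that is not a stage is sent to [[::]]. *)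
have /choice[f fP] (p : nat * seq int) : exists s',
    stage p.1 p.2 -> stage p.1.+1 s' /\ {subset p.2 <= s'}.
  have [/stage_extend[s' ? ?]|nst] := pselect (stage p.1 p.2); first by exists s'.
  by exists [::].
pose S := nat_rect (fun _ => seq int) [::] (fun k s => f (k, s)).
have SP k : stage k (S k).
  by elim: k => [|k /(fP (k, _))[]//]; split.
exists S; split=> // k l /subnK <-; elim: (l - k)%N => // i IH a /IH.
by rewrite addSn; have [_] := fP (_, _) (SP (i + k)%N); apply.
Qed.

Lemma unique_basis_of_sidon (A : set int) :
  (forall a b c d, A a -> A b -> A c -> A d ->
    a + b = c + d -> (a = c /\ b = d) \/ (a = d /\ b = c)) ->
  (forall n, exists a b, [/\ A a, A b & a + b = n]) ->
  unique_representation_basis A.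
Proof.
move=> sA rA n.
have [a [b [Aa Ab ab e]]] : exists a b, [/\ A a, A b, a <= b & a + b = n].
  have [a [b [Aa Ab e]]] := rA n.
  have [ab|ba] := leP a b; first by exists a, b.
  by exists b, a; split=> //; [exact: ltW|rewrite addrC].
suff : rep_pairs A n = [set (a, b)].
  by rewrite /rep_count => ->; rewrite fset_set1 cardfs1.
apply/seteqP; split=> [[c d] [/= Ac Ad cd e']|_ ->]; last by split.
(* In the swapped case [c = b] and [d = a], the orderings [a <= b] and [c <= d] force [a = b]. *)
by have [[-> ->]//|[ca da]] := sA _ _ _ _ Ac Ad Aa Ab (etrans e' (esym e));
  congr pair; lia.
Qed.

Lemma leq_count_in (R : realType) (A : set int) (x : R) (s : seq int) :
  uniq s -> (forall a, a \in s -> A a /\ `|a|%:~R <= x) ->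
  (size s <= count_in A (- x) x)%N.
Proof.
move=> us sA.
(* The set lies between [- N] and [N] for an [N] exceeding [|x|]; finiteness makes membership in
   [fset_set] faithful. *)
have fin : finite_set (A `&` [set a : int | a%:~R \in `[- x, x]]).
  pose N := (Num.truncn `|x|).+1.
  apply: (@sub_finite_set _ _ ((fun i : nat => i%:Z - N%:Z) @` `I_(2 * N).+1)).
    move=> a [_] /=; rewrite in_itv /= -ler_norml => ax.
    have : (`|a|%N%:R : R) < N%:R.
      apply: (le_lt_trans _ (truncnS_gt `|x|)).
      rewrite natr_absz intr_norm; apply: le_trans ax _; exact: ler_norm.
    rewrite ltr_nat => aN.
    by exists (absz (a + N%:Z)); lia.
  exact/finite_image/finite_II.
rewrite /count_in.
have -> : size s = #|` [fset a in s]%fset |%fset by rewrite card_fseq undup_id.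
apply/fsubset_leq_card/fsubsetP => a; rewrite inE /= => sa.
rewrite in_fset_set //; apply/mem_set; have [Aa ax] := sA _ sa.
by split=> //=; rewrite in_itv /= -ler_norml -intr_norm.
Qed.

Theorem theorem1p1 (R : realType) :
  exists A : set int,
    unique_representation_basis A /\
    \forall x \near +oo%R,
      8^-1 * x `^ 3^-1 <= (count_in A (- x : R) x)%:R.
Proof.
have [S [SP Smono]] := exists_stages.
exists [set a | exists k, a \in S k]; split.
  apply: unique_basis_of_sidon.
    move=> a b c d [i ia] [j jb] [k kc] [l ld].
    (* By monotonicity all four elements lie in this common stage. *)
    have [sS _ _ _ _] := SP (i + j + k + l)%N.
    by apply: sS; [apply: Smono ia|apply: Smono jb|apply: Smono kc|
                   apply: Smono ld]; lia.
  move=> n; have [k <-] := int_enum_surj n.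
  have [_ _ _ _ /(_ k (ltnSn k))[a [b [sa sb e]]]] := SP k.+1.
  by exists a, b; split=> //; exists k.+1.
near=> x.
have x64 : 64 <= x by near: x; exact: nbhs_pinfty_ge.
pose t := x `^ 3^-1.
have t3 : t ^+ 3 = x.
  by rewrite /t -powR_mulrn ?powR_ge0// -powRrM mulVf ?powRr1//.
have t0 : 0 <= t by exact: powR_ge0.
have t4 : 4 <= t.
  rewrite leNgt; apply/negP => t4.
  have : t ^+ 3 < 4 ^+ 3 by rewrite ltrXn2r.
  by rewrite t3; lra.
(* For this [k], stage [k] lies within [32 k^3 <= x / 2] of zero. Its size is
   [2 k >= k + 1 > t / 4], where [k >= 1] comes from [x >= 64]. *)
pose k := Num.truncn (t / 4).
have kt : k%:R <= t / 4 by rewrite truncn_le//; lra.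
have tk : t / 4 < k.+1%:R by exact: truncnS_gt.
have k1 : (1 <= k)%N by rewrite /k truncn_ge_nat; lra.
have [_ us zs bs _] := SP k.
apply: (@le_trans _ _ (2 * k)%:R).
  have : (k.+1%:R : R) <= (2 * k)%:R by rewrite ler_nat; lia.
  by rewrite -/t; lra.
rewrite ler_nat -zs; apply: leq_count_in => // a sa; split; first by exists k.
apply: (@le_trans _ _ (32 * k ^ 3)%:R).
  by rewrite -abszE -pmulrn ler_nat; exact: bs.
rewrite -t3 natrM natrX.
have : (k%:R : R) ^+ 3 <= (t / 4) ^+ 3 by rewrite lerXn2r ?nnegrE//; lra.
have t30 : 0 <= t ^+ 3 by exact: exprn_ge0.
by rewrite expr_div_n; lra.
Unshelve. all: by end_near.
Qed.
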